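(* Let $\mathbb{H}=\mathbb{R}$ or $\mathbb{C}$, let $\mathbf{a}_1,\dots,\mathbf{a}_n\in\mathbb{H}^p$, $b_1,\dots,b_n\in\mathbb{R}$, $\alpha>0$, $\lambda>0$, and let $F(\mathbf{x})=\frac1n\sum_{i=1}^nh_\alpha(|\langle\mathbf{a}_i,\mathbf{x}\rangle|^2-b_i)+\lambda\|\mathbf{x}\|_{1/2}^{1/2}$ for $\mathbf{x}\in\mathbb{H}^p$. Given $\mathbf{x}^0\in\mathbb{H}^p$, let $S=\{\mathbf{x}\in\mathbb{H}^p:F(\mathbf{x})\le F(\mathbf{x}^0)\}$ and $$r=\frac43\Big(\frac{2\alpha}{n}\sum_{i=1}^n\|\mathbf{a}_i\|^2+1\Big)\sup_{\mathbf{x}\in S}\|\mathbf{x}\|.$$ Let $L=\frac4n\sum_{i=1}^n(\alpha+2r^2\|\mathbf{a}_i\|^2)\|\mathbf{a}_i\|^2$ if $\mathbb{H}=\mathbb{R}$ and $L=\frac2n\sum_{i=1}^n(\alpha+2r^2\|\mathbf{a}_i\|^2)\|\mathbf{a}_i\|^2$ if $\mathbb{H}=\mathbb{C}$. Then there exists a global minimizer $\hat{\mathbf{x}}$ of $F$ over $\mathbb{H}^p$ which lies in $S$ and satisfies the fixed point inclusion $$\hat{\mathbf{x}}\in\mathcal{H}_{2\lambda\tau}\big(\hat{\mathbf{x}}-2\tau g(\hat{\mathbf{x}})\big)$$ for every $\tau\in(0,\min\{1,1/L\}]$.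
   Context: Here $\langle\mathbf{a}_i,\mathbf{x}\rangle=\mathbf{a}_i^\top\mathbf{x}$, $\|\cdot\|$ is the Euclidean norm, $\|\mathbf{x}\|_{1/2}^{1/2}=\sum_{j=1}^p|x_j|^{1/2}$. The Huber function is $h_\alpha(u)=\frac12u^2$ if $|u|\le\alpha$ and $\alpha|u|-\frac12\alpha^2$ if $|u|>\alpha$; its derivative is $h'_\alpha(u)=\min\{\max\{u,-\alpha\},\alpha\}$. Define $$g(\mathbf{x})=\frac1n\sum_{i=1}^nh'_\alpha(|\langle\mathbf{a}_i,\mathbf{x}\rangle|^2-b_i)\,\langle\mathbf{a}_i,\mathbf{x}\rangle\,\overline{\mathbf{a}}_i.$$ (In the real case $\nabla f=2g$, and in the complex case $g$ is the Wirtinger gradient with respect to $\mathbf{x}$, where $f$ is the first term of $F$.) For $\mu>0$ the (set-valued) half-thresholding operator is $\mathcal{H}_\mu(\boldsymbol{\xi})=\{\mathbf{v}\in\mathbb{H}^p:v_j\in\chi_\mu(\xi_j),\ j=1,\dots,p\}$, where for $t\in\mathbb{H}$: - if $|t|>\frac{\sqrt[3]{54}}4\mu^{2/3}$, $\chi_\mu(t)$ consists of the single value $\frac23t\Big(1+\cos\big(\frac{2\pi}3-\frac23\arccos\big(\frac\mu8(\frac{|t|}3)^{-3/2}\big)\big)\Big)$; - if $|t|=\frac{\sqrt[3]{54}}4\mu^{2/3}$, $\chi_\mu(t)=\{\frac{t}{|t|}(\mu/2)^{2/3},\,0\}$; - otherwise $\chi_\mu(t)=\{0\}$. Componentwise,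 $\mathcal{H}_\mu(\boldsymbol{\xi})$ gives the solutions of $\min_{\mathbf{v}\in\mathbb{H}^p}\|\mathbf{v}-\boldsymbol{\xi}\|^2+\mu\|\mathbf{v}\|_{1/2}^{1/2}$. *)

(* Defs.v *)
From HB Require Import structures.
From mathcomp Require Import all_boot all_order all_algebra.
From mathcomp Require Import complex.
From mathcomp Require Import all_classical all_reals all_analysis.

Set Implicit Arguments.
Unset Strict Implicit.
Unset Printing Implicit Defensive.

Import Order.TTheory GRing.Theory Num.Theory.

Local Open Scope classical_set_scope.
Local Open Scope ring_scope.

Inductive scalar_kind := RealScalar | ComplexScalar.

Definition field_of (R : realType) (k : scalar_kind) : numFieldType :=
  match k with
  | RealScalar => R
  | ComplexScalar => R[i]
  end.

(* The norm `|z| of z : R[i] lives in R[i]; the definitions below need the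
   modulus as an element of R, in both cases. *)
Definition modulus (R : realType) (k : scalar_kind) : field_of R k -> R :=
  match k with
  | RealScalar => fun z : R => `|z|
  | ComplexScalar => fun z : R[i] => Normc.normc z
  end.

Definition conj_scalar (R : realType) (k : scalar_kind) :
    field_of R k -> field_of R k :=
  match k with
  | RealScalar => fun z : R => z
  | ComplexScalar => fun z : R[i] => conjc z
  end.

Definition of_real (R : realType) (k : scalar_kind) : R -> field_of R k :=
  match k with
  | RealScalar => fun u : R => u
  | ComplexScalar => fun u : R => real_complex R u
  end.

Definition huber (R : realType) (alpha u : R) : R :=
  if `|u| <= alpha then 2^-1 * u ^+ 2 else alpha * `|u| - 2^-1 * alpha ^+ 2.

Definition dhuber (R : realType) (alpha u : R) : R :=
  Num.min (Num.max u (- alpha)) alpha.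

Section Vectors.
Variables (R : realType) (k : scalar_kind) (p : nat).
Local Notation H := (field_of R k).

(* Bilinear, not Hermitian: there is no conjugation, even over R[i]. *)
Definition dotT (a x : 'cV[H]_p) : H := (a^T *m x) ord0 ord0.

Definition norm2 (x : 'cV[H]_p) : R :=
  Num.sqrt (\sum_(j < p) modulus (x j ord0) ^+ 2).

Definition half_norm (x : 'cV[H]_p) : R :=
  \sum_(j < p) Num.sqrt (modulus (x j ord0)).

End Vectors.

Section HalfThresholding.
Variables (R : realType) (k : scalar_kind).
Local Notation H := (field_of R k).

Definition threshold (mu : R) : R := 54 `^ 3^-1 / 4 * mu `^ (2 / 3).

Definition half_shrink (mu : R) (t : H) : H :=
  of_real k (2 / 3) * t *
  of_real k (1 + cos (2 * pi / 3 -
    2 / 3 * acos (mu / 8 * (modulus t / 3) `^ (- (3 / 2))))).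

Definition chi (mu : R) (t : H) : set H :=
  if threshold mu < modulus t then [set half_shrink mu t]
  else if modulus t == threshold mu then
    [set t / of_real k (modulus t) * of_real k ((mu / 2) `^ (2 / 3)); 0]
  else [set 0].

Definition half_threshold (p : nat) (mu : R) (xi : 'cV[H]_p) : set 'cV[H]_p :=
  [set v | forall j : 'I_p, chi mu (xi j ord0) (v j ord0)].

End HalfThresholding.

Section Problem.
Variables (R : realType) (k : scalar_kind) (n p : nat).
Local Notation H := (field_of R k).
Variables (a : 'I_n -> 'cV[H]_p) (b : 'I_n -> R) (alpha lambda : R).

Definition objective (x : 'cV[H]_p) : R :=
  n%:R^-1 * \sum_(i < n) huber alpha (modulus (dotT (a i) x) ^+ 2 - b i)
  + lambda * half_norm x.

Definition grad (x : 'cV[H]_p) : 'cV[H]_p :=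
  of_real k n%:R^-1 *:
  \sum_(i < n) (of_real k (dhuber alpha (modulus (dotT (a i) x) ^+ 2 - b i)) *
                dotT (a i) x) *: map_mx (@conj_scalar R k) (a i).

Definition level_set (x0 : 'cV[H]_p) : set 'cV[H]_p :=
  [set x | objective x <= objective x0].

Definition search_radius (x0 : 'cV[H]_p) : R :=
  4 / 3 * (2 * alpha / n%:R * \sum_(i < n) norm2 (a i) ^+ 2 + 1) *
  sup [set norm2 x | x in level_set x0].

Definition lipschitz_const (x0 : 'cV[H]_p) : R :=
  (match k with RealScalar => 4 | ComplexScalar => 2 end) / n%:R *
  \sum_(i < n) (alpha + 2 * search_radius x0 ^+ 2 * norm2 (a i) ^+ 2)
               * norm2 (a i) ^+ 2.

End Problem.

(* Main.v *)
Require Import Defs.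
From mathcomp Require Import all_boot all_order all_algebra.
From mathcomp Require Import complex.
From mathcomp Require Import all_classical all_reals all_analysis.
From mathcomp Require Import ring lra.

Import Order.TTheory GRing.Theory Num.Theory.
Import numFieldNormedType.Exports.

Local Open Scope classical_set_scope.
Local Open Scope ring_scope.

(* The sublevel sets of F are bounded because of the half-norm term, so F has a
   global minimizer x.  Write xi = x - 2 tau g(x).  Replacing one coordinate
   x_j by w with |w| <= |xi_j| stays in the ball of radius r, where the smooth
   part f of F satisfies
     f(v) <= f(x) + 2 Re <g(x), v - x> + (L / 2) ||v - x||^2.
   With F(x) <= F(v) and tau L <= 1 this says that x_j minimizes
   |w - xi_j|^2 + 2 lambda tau |w|^(1/2) over |w| <= |xi_j|.  Such a minimizer
   is on the ray of xi_j, and the substitution |w| = y^2 turns the problem into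
   the minimization of a quartic in y, solved by the trigonometric root of its
   derivative. *)

(** * The threshold and the trigonometric root of the critical-point equation *)

Section RealLemmas.
Context {R : realType}.
Implicit Types s mu x y Y alpha u v : R.

Lemma powR_cube_third x m : 0 <= x -> (x `^ (m%:R / 3)) ^+ 3 = x ^+ m.
Proof.
move=> x0; rewrite -[LHS]powR_mulrn ?powR_ge0// -powRrM.
by rewrite -mulrA mulVf ?mulr1 ?powR_mulrn// pnatr_eq0.
Qed.

Lemma threshold_ge0 mu : 0 <= threshold mu.
Proof. by rewrite /threshold !mulr_ge0 ?powR_ge0// invr_ge0. Qed.

(** Cubing clears the fractional powers, so comparisons with the threshold become polynomial
    inequalities in [mu] and [s]. *)
Lemma threshold_cube mu : 0 <= mu -> 32 * threshold mu ^+ 3 = 27 * mu ^+ 2.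
Proof.
move=> mu0; rewrite /threshold !exprMn (powR_cube_third _ 2)//.
have -> : (54 `^ 3^-1) ^+ 3 = 54 :> R.
  by rewrite -[3^-1]mul1r (powR_cube_third _ 1)// ?expr1.
by field.
Qed.

Lemma cube_le x y : 0 <= x -> 0 <= y -> (x ^+ 3 <= y ^+ 3) = (x <= y).
Proof. by move=> x0 y0; rewrite ler_pXn2r. Qed.

Lemma cube_lt x y : 0 <= x -> 0 <= y -> (x ^+ 3 < y ^+ 3) = (x < y).
Proof. by move=> x0 y0; rewrite ltr_pXn2r. Qed.

Lemma cube_inj x y : 0 <= x -> 0 <= y -> x ^+ 3 = y ^+ 3 -> x = y.
Proof. by move=> x0 y0 xy; apply/le_anti; rewrite -(cube_le x y)// -(cube_le y x)// xy lexx. Qed.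

Lemma cos_triple x : cos (x *+ 3) = 4 * cos x ^+ 3 - 3 * cos x.
Proof.
rewrite mulrSr cosD cos_mulr2n sin_mulr2n.
have := cos2Dsin2 x; set c := cos x; set t := sin x => ct.
have tt : t * t = 1 - c ^+ 2 by rewrite -ct; ring.
by ring: tt.
Qed.

(** [Y] is a critical point of [quartic mu s], a root of Y^3 - s Y + mu / 4. With q = sqrt (s / 3)
    and Y = 2 q cos th, the triple-angle formula reduces this to cos (3 th) = - mu / (8 q^3). The
    bound [2 * s < 3 * Y ^+ 2] makes [Y] the strict minimizer on y >= 0. *)
Lemma shrink_root mu s : 0 < mu -> threshold mu < s ->
  exists Y, [/\ 0 < Y, mu = 4 * Y * (s - Y ^+ 2), 2 * s < 3 * Y ^+ 2 &
    Y ^+ 2 = 2 / 3 * s * (1 + cos (2 * pi / 3 -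
      2 / 3 * acos (mu / 8 * (s / 3) `^ (- (3 / 2)))))].
Proof.
move=> mu0 Ts; have T0 := threshold_ge0 mu.
have s0 : 0 < s by exact: le_lt_trans Ts.
pose q := Num.sqrt (s / 3); have q0 : 0 < q by rewrite sqrtr_gt0 divr_gt0.
have qq : q ^+ 2 = s / 3 by rewrite sqr_sqrtr// divr_ge0// ltW.
have sq : s = 3 * q ^+ 2 by rewrite qq; field.
have -> : (s / 3) `^ (- (3 / 2)) = (q ^+ 3)^-1.
  rewrite -qq -(powR_mulrn 2) ?ltW// -powRrM mulrN mulrC mulfVK ?pnatr_eq0//.
  by rewrite powRN powR_mulrn ?ltW.
pose A := mu / 8 * (q ^+ 3)^-1; rewrite -/A.
have muA : mu = 8 * A * q ^+ 3 by rewrite /A; field; rewrite gt_eqF.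
have A0 : 0 < A by rewrite !mulr_gt0 ?invr_gt0 ?exprn_gt0.
(* The threshold is exactly the value of [s] at which A = 1 / sqrt 2, that is, acos A = pi / 4. *)
have A2 : 2 * A ^+ 2 < 1.
  have : 27 * mu ^+ 2 < 32 * s ^+ 3.
    rewrite -threshold_cube ?(ltW mu0)// ltr_pM2l// cube_lt ?(ltW s0)//.
  have -> : 27 * mu ^+ 2 = 864 * (2 * A ^+ 2) * q ^+ 6 by rewrite muA; ring.
  have -> : 32 * s ^+ 3 = 864 * 1 * q ^+ 6 by rewrite sq; ring.
  by rewrite (ltr_pM2r (exprn_gt0 6 q0)) => ?; lra.
have A1 : -1 <= A <= 1 by apply/andP; split; nra.
have [/andP[a0 api] cA] := acos_def A1.
have p0 : 0 < pi :> R := pi_gt0 R.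
have a4 : pi / 4 < acos A.
  rewrite ltNge; apply/negP => a4.
  have : 0 <= cos (acos A *+ 2).
    by apply: cos_ge0_pihalf; apply/andP; split; lra.
  by rewrite cos_mulr2n cA; lra.
(* A third of the angle with cosine [- A]. Since acos A > pi / 4, it is below pi / 4, and cos (2 th)
   > 0 amounts to [2 * s < 3 * Y ^+ 2]. *)
set th := (pi - acos A) / 3.
have -> : 2 * pi / 3 - 2 / 3 * acos A = th *+ 2 by rewrite /th; field.
have c0 : 0 < cos th.
  by apply: cos_gt0_pihalf; apply/andP; split; rewrite /th; lra.
have c2 : 0 < cos (th *+ 2).
  by apply: cos_gt0_pihalf; apply/andP; split; rewrite /th; lra.
have c3 : cos (th *+ 3) = - A.
  have -> : th *+ 3 = pi - acos A by rewrite /th; field.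
  by rewrite addrC cosDpi cosN cA.
rewrite cos_triple in c3; rewrite cos_mulr2n in c2 *.
exists (2 * q * cos th); split; first by rewrite !mulr_gt0.
- by rewrite muA sq -[A]opprK -c3; ring.
- by have := mulr_gt0 (exprn_gt0 2 q0) c2; rewrite sq; lra.
- by rewrite sq; field.
Qed.

(** * Minimization of the quartic above and below the threshold *)

Definition quartic mu s y : R := (y ^+ 2 - s) ^+ 2 + mu * y.

(* At a critical point [Y], [quartic mu s y - quartic mu s Y] equals
   [(y - Y) ^ 2 * (y ^ 2 + 2 * Y * y + (3 * Y ^ 2 - 2 * s))]. *)

Lemma quartic_min_gt mu s y : 0 < mu -> threshold mu < s -> 0 <= y ->
  (forall x, 0 <= x -> x ^+ 2 <= s -> quartic mu s y <= quartic mu s x) ->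
  y ^+ 2 = 2 / 3 * s * (1 + cos (2 * pi / 3 -
      2 / 3 * acos (mu / 8 * (s / 3) `^ (- (3 / 2))))).
Proof.
move=> mu0 Ts y0 ymin; have [Y [Y0 crit sY <-]] := shrink_root _ _ mu0 Ts.
have Ys : Y ^+ 2 <= s.
  by move: mu0; rewrite crit pmulr_rgt0 ?mulr_gt0// subr_gt0 => /ltW.
have := ymin Y (ltW Y0) Ys.
have -> : quartic mu s y =
    quartic mu s Y + (y - Y) ^+ 2 * (y ^+ 2 + 2 * Y * y + (3 * Y ^+ 2 - 2 * s)).
  by rewrite /quartic crit; ring.
rewrite gerDl pmulr_lle0; last first.
  by rewrite ltr_wpDl ?subr_gt0// addr_ge0 ?sqr_ge0// !mulr_ge0// ltW.
move=> h; suff -> : y = Y by [].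
by apply/eqP; rewrite -subr_eq0 -sqrf_eq0 eq_le h sqr_ge0.
Qed.

(** Comparison with 0: for c = sqrt (2 s / 3), the increment over the value at 0 is y ((y - c)^2 (y
    + 2 c) + (mu - 2 c^3)). Below the threshold mu >= 2 c^3, so a nonzero minimizer forces mu = 2
    c^3 and y = c. *)
Lemma quartic_min_le mu s y : 0 < mu -> 0 <= s -> s <= threshold mu -> 0 <= y ->
  (forall x, 0 <= x -> x ^+ 2 <= s -> quartic mu s y <= quartic mu s x) ->
  y = 0 \/ [/\ s = threshold mu, y ^+ 2 <= s & y ^+ 2 = (mu / 2) `^ (2 / 3)].
Proof.
move=> mu0 s0 sT y0 ymin.
have [->|yn0] := eqVneq y 0; [by left|right].
have {}y0 : 0 < y by rewrite lt_def yn0.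
pose c := Num.sqrt (2 * s / 3); have c0 : 0 <= c by exact: sqrtr_ge0.
have cc : c ^+ 2 = 2 * s / 3 by rewrite sqr_sqrtr// divr_ge0// mulr_ge0.
have sc : s = 3 / 2 * c ^+ 2 by rewrite cc; field.
have muc : 2 * c ^+ 3 <= mu.
  rewrite -(@ler_pXn2r _ 2) ?nnegrE ?(ltW mu0)// ?mulr_ge0 ?exprn_ge0//.
  have : 32 * s ^+ 3 <= 27 * mu ^+ 2.
    by rewrite -threshold_cube ?(ltW mu0)// ler_pM2l// cube_le ?threshold_ge0.
  rewrite sc (_ : 32 * (3 / 2 * c ^+ 2) ^+ 3 = 27 * (2 * c ^+ 3) ^+ 2).
    by rewrite ler_pM2l.
  by field.
have := ymin 0 (lexx 0); rewrite expr0n => /(_ s0).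
have -> : quartic mu s y = quartic mu s 0 +
    y * ((y - c) ^+ 2 * (y + 2 * c) + (mu - 2 * c ^+ 3)).
  by rewrite /quartic sc; field.
rewrite gerDl pmulr_rle0// => h.
have ge0 : 0 <= (y - c) ^+ 2 * (y + 2 * c).
  by rewrite mulr_ge0 ?sqr_ge0// addr_ge0 ?mulr_ge0// ltW.
have mu_c : mu = 2 * c ^+ 3 by lra.
have yc : y = c.
  have : (y - c) ^+ 2 * (y + 2 * c) == 0 by apply/eqP; lra.
  rewrite mulf_eq0 sqrf_eq0 subr_eq0 => /orP[/eqP//|].
  by rewrite gt_eqF// ltr_wpDr// mulr_ge0.
split.
- apply: cube_inj => //; first exact: threshold_ge0.
  apply: (@mulfI _ 32); rewrite ?pnatr_eq0// (threshold_cube _ (ltW mu0)) sc mu_c.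
  by field.
- by rewrite yc sc; have := sqr_ge0 c; lra.
- apply: cube_inj; [exact: sqr_ge0|exact: powR_ge0|].
  by rewrite (powR_cube_third _ 2) ?divr_ge0 ?(ltW mu0)// yc mu_c; field.
Qed.

(** * The Huber function *)

Definition capped_norm alpha u : R := Num.min `|u| alpha.

(** A formula without case distinction, from which continuity follows. *)
Lemma huberE alpha u : huber alpha u =
  capped_norm alpha u * `|u| - 2^-1 * capped_norm alpha u ^+ 2.
Proof.
rewrite /huber /capped_norm; have [h|h] := leP `|u| alpha; last by [].
by rewrite -(real_normK (num_real u)); field.
Qed.

Lemma huber_ge0 alpha u : 0 <= alpha -> 0 <= huber alpha u.
Proof.
move=> a0; rewrite /huber; case: ifPn => [_|].
  by rewrite mulr_ge0 ?sqr_ge0 ?invr_ge0.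
by rewrite -ltNge => h; nra.
Qed.

Lemma normr_dhuber_le alpha u : 0 <= alpha -> `|dhuber alpha u| <= alpha.
Proof.
move=> a0; rewrite ler_norml /dhuber ge_min lexx orbT andbT le_min le_max lexx.
by rewrite orbT /= ge0_cp.
Qed.

Lemma huber_cases alpha u : 0 < alpha ->
  [\/ [/\ - alpha <= u, u <= alpha, huber alpha u = 2^-1 * u ^+ 2
        & dhuber alpha u = u],
      [/\ alpha < u, huber alpha u = alpha * u - 2^-1 * alpha ^+ 2
        & dhuber alpha u = alpha]
    | [/\ u < - alpha, huber alpha u = - (alpha * u) - 2^-1 * alpha ^+ 2
        & dhuber alpha u = - alpha]].
Proof.
move=> a0; rewrite /huber /dhuber ler_norml.
have [au|ua] := leP (- alpha) u; have [ua'|au'] := leP u alpha => /=.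
- by constructor 1; split.
- by constructor 2; split; rewrite // gtr0_norm//; lra.
- constructor 3; split; rewrite ?ltr0_norm ?mulrN//; first lra.
  by apply/min_idPl; lra.
- lra.
Qed.

(** The quadratic upper bound expected from a 1-Lipschitz derivative, checked on the nine pairs of
    pieces containing [u] and [v]. *)
Lemma huber_descent alpha u v : 0 < alpha ->
  huber alpha v <= huber alpha u + dhuber alpha u * (v - u)
                   + 2^-1 * (v - u) ^+ 2.
Proof.
move=> a0; have := sqr_ge0 (v - alpha); have := sqr_ge0 (v + alpha).
have := sqr_ge0 (v - u).
case: (huber_cases alpha u a0) => [[? ? -> ->]|[? -> ->]|[? -> ->]];
case: (huber_cases alpha v a0) => [[? ? -> _]|[? -> _]|[? -> _]]; nra.
Qed.

End RealLemmas.

(** * Real and complex scalars treated together through their parts *)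

Definition re_part (R : realType) (k : scalar_kind) : field_of R k -> R :=
  match k with
  | RealScalar => fun z : R => z
  | ComplexScalar => fun z : R[i] => complex.Re z
  end.

Definition im_part (R : realType) (k : scalar_kind) : field_of R k -> R :=
  match k with
  | RealScalar => fun=> 0
  | ComplexScalar => fun z : R[i] => complex.Im z
  end.

Definition of_parts (R : realType) (k : scalar_kind) (x y : R) : field_of R k :=
  match k with
  | RealScalar => x
  | ComplexScalar => Complex x y
  end.

Arguments re_part {R k}.
Arguments im_part {R k}.
Arguments of_parts {R k}.

Section Scalars.
Context {R : realType} {k : scalar_kind}.
Local Notation H := (field_of R k).
Implicit Types x y z t w : H.
Implicit Types r s mu : R.

Lemma scalar_ext x y : re_part x = re_part y -> im_part x = im_part y -> x = y.
Proof. by case: k x y => [//|] [a b] [c d] /= -> ->. Qed.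

Lemma re_partD x y : re_part (x + y) = re_part x + re_part y.
Proof. by case: k x y => [//|] [a b] [c d]. Qed.

Lemma im_partD x y : im_part (x + y) = im_part x + im_part y.
Proof. by case: k x y => [x y|[a b] [c d]] //=; rewrite addr0. Qed.

Lemma re_partN x : re_part (- x) = - re_part x.
Proof. by case: k x => [//|] [a b]. Qed.

Lemma im_partN x : im_part (- x) = - im_part x.
Proof. by case: k x => [x|[a b]] //=; rewrite oppr0. Qed.

Lemma re_partM x y :
  re_part (x * y) = re_part x * re_part y - im_part x * im_part y.
Proof. by case: k x y => [x y|[a b] [c d]] //=; rewrite mulr0 subr0. Qed.

Lemma im_partM x y :
  im_part (x * y) = re_part x * im_part y + im_part x * re_part y.
Proof. by case: k x y => [x y|[a b] [c d]] //=; rewrite mulr0 mul0r addr0. Qed.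

Lemma re_part_conj x : re_part (conj_scalar x) = re_part x.
Proof. by case: k x => [//|] [a b]. Qed.

Lemma im_part_conj x : im_part (conj_scalar x) = - im_part x.
Proof. by case: k x => [x|[a b]] //=; rewrite oppr0. Qed.

Lemma re_part_of_real r : re_part (of_real k r) = r.
Proof. by case: k. Qed.

Lemma im_part_of_real r : im_part (of_real k r) = 0.
Proof. by case: k. Qed.

Lemma of_partsK x : of_parts (re_part x) (im_part x) = x.
Proof. by case: k x => [//|] [a b]. Qed.

Lemma re_part0 : re_part (0 : H) = 0.
Proof. by case: k. Qed.

Lemma im_part0 : im_part (0 : H) = 0.
Proof. by case: k. Qed.

(** Rewriting with these rules turns a scalar identity into a real polynomial identity, so one proof
    serves both fields. *)
Definition parts_rules := (re_partD, im_partD, re_partN, im_partN, re_partM,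
  im_partM, re_part_conj, im_part_conj, re_part_of_real, im_part_of_real,
  re_part0, im_part0).

Lemma modulusE x : modulus x = Num.sqrt (re_part x ^+ 2 + im_part x ^+ 2).
Proof.
case: k x => [x|[a b]] //=.
by rewrite expr0n addr0 sqrtr_sqr.
Qed.

Lemma modulus_ge0 x : 0 <= modulus x.
Proof. by rewrite modulusE sqrtr_ge0. Qed.

Lemma sqr_modulus x : modulus x ^+ 2 = re_part x ^+ 2 + im_part x ^+ 2.
Proof. by rewrite modulusE sqr_sqrtr// addr_ge0 ?sqr_ge0. Qed.

Lemma eq_modulus x r : 0 <= r -> modulus x ^+ 2 = r ^+ 2 -> modulus x = r.
Proof.
by move=> r0 /eqP; rewrite eqrXn2 ?modulus_ge0// => /eqP.
Qed.

Lemma modulus_eq0 x : modulus x = 0 -> x = 0.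
Proof.
move=> x0; have := sqr_modulus x; rewrite x0 expr0n => /esym/eqP.
rewrite paddr_eq0 ?sqr_ge0// !sqrf_eq0 => /andP[/eqP rx /eqP ix].
by apply: scalar_ext; rewrite ?rx ?ix parts_rules.
Qed.

Lemma modulus0 : modulus (0 : H) = 0.
Proof. by rewrite modulusE !parts_rules expr0n addr0 sqrtr0. Qed.

Lemma modulusM x y : modulus (x * y) = modulus x * modulus y.
Proof.
apply: eq_modulus; first by rewrite mulr_ge0 ?modulus_ge0.
by rewrite exprMn !sqr_modulus !parts_rules; ring.
Qed.

Lemma modulus_of_real r : modulus (of_real k r) = `|r|.
Proof. by rewrite modulusE !parts_rules expr0n addr0 sqrtr_sqr. Qed.

Lemma modulus_conj x : modulus (conj_scalar x) = modulus x.
Proof. by rewrite !modulusE !parts_rules sqrrN. Qed.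

(* Re (x * conj y). *)
Definition inner x y : R := re_part x * re_part y + im_part x * im_part y.

Lemma innerD x y z : inner (x + y) z = inner x z + inner y z.
Proof. by rewrite /inner !parts_rules; ring. Qed.

Lemma inner0 z : inner 0 z = 0.
Proof. by rewrite /inner !parts_rules; ring. Qed.

Lemma inner_scale r x y : inner (of_real k r * x) y = r * inner x y.
Proof. by rewrite /inner !parts_rules; ring. Qed.

Lemma inner_adjoint x y z : inner (x * conj_scalar y) z = inner x (y * z).
Proof. by rewrite /inner !parts_rules; ring. Qed.

Lemma sqr_modulusD x y :
  modulus (x + y) ^+ 2 = modulus x ^+ 2 + 2 * inner x y + modulus y ^+ 2.
Proof. by rewrite !sqr_modulus /inner !parts_rules; ring. Qed.

Lemma sqr_modulusB x y :
  modulus (x - y) ^+ 2 = modulus x ^+ 2 - 2 * inner x y + modulus y ^+ 2.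
Proof. by rewrite !sqr_modulus /inner !parts_rules; ring. Qed.

Lemma inner_le x y : `|inner x y| <= modulus x * modulus y.
Proof.
rewrite -(@ler_pXn2r _ 2) ?nnegrE ?mulr_ge0 ?modulus_ge0//.
rewrite real_normK ?num_real// exprMn !sqr_modulus -subr_ge0 /inner.
set a := re_part x; set b := im_part x; set c := re_part y; set d := im_part y.
by rewrite (_ : _ - _ = (a * d - b * c) ^+ 2) ?sqr_ge0//; ring.
Qed.

Lemma modulusD_le x y : modulus (x + y) <= modulus x + modulus y.
Proof.
rewrite -(@ler_pXn2r _ 2) ?nnegrE ?addr_ge0 ?modulus_ge0//.
by rewrite sqr_modulusD; have /ler_normlW := inner_le x y; nra.
Qed.

Lemma sqr_modulus_diff_le x y : (modulus x - modulus y) ^+ 2 <= modulus (x - y) ^+ 2.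
Proof. by rewrite sqr_modulusB; have /ler_normlW := inner_le x y; lra. Qed.

Lemma of_realM r s : of_real k (r * s) = of_real k r * of_real k s.
Proof. by apply: scalar_ext; rewrite !parts_rules; ring. Qed.

Lemma of_realV r : of_real k r^-1 = (of_real k r)^-1.
Proof. by case: k => //=; rewrite fmorphV. Qed.

(* [modulus (z - t) = |modulus z - modulus t|] forces [z] onto the ray of [t]. *)
Lemma aligned z t : 0 < modulus t ->
  modulus (z - t) ^+ 2 <= (modulus z - modulus t) ^+ 2 ->
  z = of_real k (modulus z / modulus t) * t.
Proof.
move=> t0 zt; apply/eqP; rewrite -subr_eq0; apply/eqP/modulus_eq0/eqP.
rewrite -sqrf_eq0 eq_le sqr_ge0 andbT.
move: zt; rewrite !sqr_modulusB modulusM modulus_of_real.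
rewrite ger0_norm ?divr_ge0 ?modulus_ge0// divfK ?gt_eqF//.
rewrite (_ : inner z (_ * t) = modulus z / modulus t * inner z t); last first.
  by rewrite /inner !parts_rules; ring.
set a := modulus z; set s := modulus t in t0 *; set i := inner z t => zt.
have a0 : 0 <= a by exact: modulus_ge0.
have zs : a * s <= i by lra.
rewrite -(ler_pM2l t0) mulr0.
rewrite (_ : s * _ = 2 * a * (a * s - i)); last by field; rewrite gt_eqF.
by rewrite mulr_ge0_le0 ?mulr_ge0// subr_le0.
Qed.

(** * The scalar proximal problem *)

Definition prox_objective mu t z : R :=
  modulus (z - t) ^+ 2 + mu * Num.sqrt (modulus z).

Lemma prox_objective_ray mu t r : 0 < modulus t -> 0 <= r ->
  prox_objective mu t (of_real k (r ^+ 2 / modulus t) * t)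
  = quartic mu (modulus t) r.
Proof.
move=> t0 r0; rewrite /prox_objective /quartic.
have -> : modulus (of_real k (r ^+ 2 / modulus t) * t) = r ^+ 2.
  rewrite modulusM modulus_of_real ger0_norm ?divr_ge0 ?sqr_ge0 ?modulus_ge0//.
  by rewrite divfK// gt_eqF.
rewrite sqrtr_sqr ger0_norm//; congr (_ + _).
rewrite (_ : _ - t = of_real k (r ^+ 2 / modulus t - 1) * t); last first.
  by apply: scalar_ext; rewrite !parts_rules; ring.
rewrite modulusM modulus_of_real exprMn real_normK ?num_real//.
by field; rewrite gt_eqF.
Qed.

(** Since |z - t| >= ||z| - |t||, with equality on the ray of [t], sqrt |z| minimizes the quartic.
    Competitors are limited to |w| <= |t| because the descent inequality is available only in a
    ball. *)
Lemma prox_minimizer_chi mu t z : 0 < mu ->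
  (forall w, modulus w <= modulus t ->
     prox_objective mu t z <= prox_objective mu t w) ->
  chi mu t z.
Proof.
move=> mu0 zmin; set s := modulus t in zmin.
(* If t = 0 there is no ray, but the competitor 0 forces z = 0. *)
have [s0|sn0] := eqVneq s 0.
  have t0 : t = 0 by exact: modulus_eq0.
  have z0 : z = 0.
    have := zmin 0; rewrite modulus0 /s modulus_ge0 => /(_ isT).
    rewrite /prox_objective t0 !subr0 modulus0 sqrtr0 mulr0 addr0 expr0n /= => h.
    apply/modulus_eq0/eqP; rewrite -sqrf_eq0 eq_le sqr_ge0 andbT.
    by apply: le_trans h; rewrite lerDl mulr_ge0 ?sqrtr_ge0// ltW.
  rewrite /chi z0 -/s s0 ltNge threshold_ge0 /=.
  by case: ifP => _ /=; [right|].
have s_gt0 : 0 < s by rewrite lt_def sn0 modulus_ge0.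
pose y := Num.sqrt (modulus z); have y0 : 0 <= y by exact: sqrtr_ge0.
have yy : y ^+ 2 = modulus z by rewrite sqr_sqrtr ?modulus_ge0.
have zy : quartic mu s y <= prox_objective mu t z.
  by rewrite /quartic yy /prox_objective lerD2r sqr_modulus_diff_le.
have ymin (x : R) : 0 <= x -> x ^+ 2 <= s -> prox_objective mu t z <= quartic mu s x.
  move=> x0 xs; rewrite -prox_objective_ray//; apply: zmin.
  rewrite modulusM modulus_of_real ger0_norm ?divr_ge0 ?sqr_ge0 ?modulus_ge0//.
  by rewrite divfK// gt_eqF.
have ymin' (x : R) : 0 <= x -> x ^+ 2 <= s -> quartic mu s y <= quartic mu s x.
  by move=> x0 xs; exact: le_trans zy (ymin _ x0 xs).
(* When |z| <= |t|, the point of the ray with modulus |z| is an admissible competitor, which gives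
   the hypothesis of [aligned]. *)
have zray : y ^+ 2 <= s -> z = of_real k (y ^+ 2 / s) * t.
  move=> ys; rewrite yy; apply: aligned => //.
  have := ymin _ y0 ys; rewrite /prox_objective /quartic -/y yy lerD2r.
  by [].
have sne : s != 0 by rewrite gt_eqF.
rewrite /chi -/s; case: ifPn => [Ts|].
  have yE := quartic_min_gt _ _ _ mu0 Ts y0 ymin'.
  have [Y [Y0 crit _ YE]] := shrink_root _ _ mu0 Ts.
  have ys : y ^+ 2 <= s.
    rewrite yE -YE; have : 0 < 4 * Y * (s - Y ^+ 2) by rewrite -crit.
    by rewrite pmulr_rgt0 ?mulr_gt0// subr_gt0 => /ltW.
  rewrite /= /half_shrink -/s mulrAC -of_realM zray// yE.
  by congr (of_real k _ * t); field.
rewrite -leNgt => sT.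
have [y00|[sE ys yE]] := quartic_min_le _ _ _ mu0 (ltW s_gt0) sT y0 ymin'.
  have -> : z = 0 by apply: modulus_eq0; rewrite -yy y00 expr0n.
  by case: ifP => _ /=; [right|].
rewrite -sE eqxx; left.
by rewrite zray// yE of_realM of_realV mulrC mulrCA mulrC.
Qed.

End Scalars.

(** * Finite sums, one-coordinate updates and descent of the smooth part *)

Lemma sum_mul_sqr_le (R : realFieldType) (I : finType) (x y : I -> R) :
  (\sum_i x i * y i) ^+ 2 <= (\sum_i x i ^+ 2) * (\sum_i y i ^+ 2).
Proof.
set A := \sum_i x i ^+ 2; set B := \sum_i x i * y i; set C := \sum_i y i ^+ 2.
have A0 : 0 <= A by apply: sumr_ge0 => i _; exact: sqr_ge0.
have [Az|Apos] := eqVneq A 0.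
  suff -> : B = 0 by rewrite Az expr0n mul0r.
  apply: big1 => i _; have /eqP := Az.
  rewrite psumr_eq0 => [/allP/(_ i)|j _]; last exact: sqr_ge0.
  by rewrite mem_index_enum sqrf_eq0 => /(_ isT)/eqP ->; rewrite mul0r.
(* Cauchy-Schwarz: this sum expands to A (A C - B^2), and A > 0. *)
have : 0 <= \sum_i (A * y i - B * x i) ^+ 2.
  by apply: sumr_ge0 => i _; exact: sqr_ge0.
rewrite (eq_bigr (fun i => A ^+ 2 * y i ^+ 2 - (2 * A * B) * (x i * y i)
  + B ^+ 2 * x i ^+ 2)); last by move=> i _; ring.
rewrite big_split sumrB -!mulr_sumr -/A -/B -/C /=.
rewrite (_ : _ + _ = A * (A * C - B ^+ 2)); last by ring.
by rewrite pmulr_rge0 ?subr_ge0// lt_def Apos.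
Qed.

Lemma sum_update (V : zmodType) (I : finType) (T : Type) (F : I -> T -> V)
    (x : I -> T) (j : I) (w : T) :
  \sum_i F i (if i == j then w else x i) =
  \sum_i F i (x i) + (F j w - F j (x j)).
Proof.
rewrite (bigD1 j)//= eqxx [in RHS](bigD1 j)//=.
rewrite [X in _ + X](eq_bigr (fun i => F i (x i))); last first.
  by move=> i /negbTE ->.
by rewrite addrAC addrC subrKC addrC.
Qed.

Section Descent.
Context {R : realType} {k : scalar_kind} {p : nat}.
Local Notation H := (field_of R k).
Implicit Types x y : 'cV[H]_p.
Implicit Types d w u e : H.

Lemma dotTE x y : dotT x y = \sum_j x j ord0 * y j ord0.
Proof. by rewrite /dotT mxE; apply: eq_bigr => j _; rewrite mxE. Qed.

Lemma norm2_ge0 x : 0 <= norm2 x.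
Proof. exact: sqrtr_ge0. Qed.

Lemma sqr_norm2 x : norm2 x ^+ 2 = \sum_j modulus (x j ord0) ^+ 2.
Proof. by rewrite sqr_sqrtr// sumr_ge0// => j _; exact: sqr_ge0. Qed.

Lemma modulus_le_norm2 x j : modulus (x j ord0) <= norm2 x.
Proof.
rewrite -(@ler_pXn2r _ 2) ?nnegrE ?modulus_ge0 ?norm2_ge0// sqr_norm2.
by rewrite (bigD1 j)//= lerDl sumr_ge0// => i _; exact: sqr_ge0.
Qed.

Lemma modulus_sum_le (I : finType) (F : I -> H) :
  modulus (\sum_i F i) <= \sum_i modulus (F i).
Proof.
elim/big_ind2: _ => [|a b c d ab cd|//]; first by rewrite modulus0.
by apply: le_trans (modulusD_le _ _) _; exact: lerD.
Qed.

Lemma modulus_dotT_le x y : modulus (dotT x y) <= norm2 x * norm2 y.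
Proof.
rewrite dotTE; apply: le_trans (modulus_sum_le _ _) _.
under eq_bigr do rewrite modulusM.
rewrite -(@ler_pXn2r _ 2) ?nnegrE ?mulr_ge0 ?norm2_ge0//; last first.
  by rewrite sumr_ge0// => j _; rewrite mulr_ge0 ?modulus_ge0.
by rewrite exprMn !sqr_norm2 sum_mul_sqr_le.
Qed.

Definition update x (j : 'I_p) w : 'cV[H]_p :=
  \col_i (if i == j then w else x i ord0).

Lemma dotT_update y x j w :
  dotT y (update x j w) = dotT y x + y j ord0 * (w - x j ord0).
Proof.
rewrite !dotTE mulrBr.
rewrite -(sum_update _ _ _ (fun i t => y i ord0 * t) (fun i => x i ord0)).
by apply: eq_bigr => i _; rewrite mxE.
Qed.

Lemma sqr_norm2_update x j w : norm2 (update x j w) ^+ 2 =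
  norm2 x ^+ 2 + (modulus w ^+ 2 - modulus (x j ord0) ^+ 2).
Proof.
rewrite !sqr_norm2.
rewrite -(sum_update _ _ _ (fun i t => modulus t ^+ 2) (fun i => x i ord0)).
by apply: eq_bigr => i _; rewrite mxE.
Qed.

Lemma half_norm_update x j w : half_norm (update x j w) =
  half_norm x + (Num.sqrt (modulus w) - Num.sqrt (modulus (x j ord0))).
Proof.
rewrite -(sum_update _ _ _ (fun i t => Num.sqrt (modulus t)) (fun i => x i ord0)).
by apply: eq_bigr => i _; rewrite mxE.
Qed.

(** The squared norm grows by at most 2 |x_j| delta + delta^2, and |x_j| is at most the norm of
    [x]. *)
Lemma norm2_update_le x j w delta : 0 <= delta ->
  modulus w <= modulus (x j ord0) + delta ->
  norm2 (update x j w) <= norm2 x + delta.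
Proof.
move=> d0 wd; have := modulus_le_norm2 x j; have := norm2_ge0 x.
have := modulus_ge0 w; have := modulus_ge0 (x j ord0) => *.
rewrite -(@ler_pXn2r _ 2) ?nnegrE ?addr_ge0 ?norm2_ge0//.
rewrite sqr_norm2_update.
have : modulus w ^+ 2 <= (modulus (x j ord0) + delta) ^+ 2.
  by rewrite ler_pXn2r ?nnegrE ?addr_ge0.
by nra.
Qed.

(* Applying [huber_descent] to the two values of [|u|^2 - beta] needs no
   derivative of [huber], and yields exactly the constant of the theorem. *)
Lemma huber_sqr_modulus_descent (alpha beta rho : R) u e : 0 < alpha ->
  modulus u <= rho -> modulus (u + e) <= rho ->
  huber alpha (modulus (u + e) ^+ 2 - beta) <=
  huber alpha (modulus u ^+ 2 - beta)
  + dhuber alpha (modulus u ^+ 2 - beta) * (2 * inner u e)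
  + (alpha + 2 * rho ^+ 2) * modulus e ^+ 2.
Proof.
move=> a0 ur uer.
apply: le_trans (huber_descent _ (modulus u ^+ 2 - beta) _ a0) _.
have /ler_normlP[_ dh] := normr_dhuber_le _ (modulus u ^+ 2 - beta) (ltW a0).
set h := dhuber _ _ in dh *.
rewrite -!addrA lerD2l.
have eE : modulus (u + e) ^+ 2 - modulus u ^+ 2 = 2 * inner u e + modulus e ^+ 2.
  by rewrite sqr_modulusD; ring.
(* In the difference of squares one factor is at most |e| in modulus, the other at most 2 rho. *)
have dE : (modulus (u + e) ^+ 2 - modulus u ^+ 2) ^+ 2 <=
    4 * rho ^+ 2 * modulus e ^+ 2.
  rewrite subr_sqr exprMn mulrC ler_pM ?sqr_ge0//.
    rewrite (_ : 4 * rho ^+ 2 = (rho + rho) ^+ 2); last by ring.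
    by rewrite ler_pXn2r ?nnegrE ?addr_ge0 ?modulus_ge0 ?lerD// (le_trans _ ur)
      ?modulus_ge0.
  by apply: le_trans (sqr_modulus_diff_le _ _) _; rewrite addrAC subrr add0r.
have -> : modulus (u + e) ^+ 2 + (- beta - (modulus u ^+ 2 - beta)) =
  modulus (u + e) ^+ 2 - modulus u ^+ 2 by ring.
have he : h * modulus e ^+ 2 <= alpha * modulus e ^+ 2.
  by rewrite ler_wpM2r ?sqr_ge0.
by move: dE; rewrite eE; lra.
Qed.

Context {n : nat} (a : 'I_n -> 'cV[H]_p) (b : 'I_n -> R) (alpha : R).

Definition smooth_part x : R :=
  n%:R^-1 * \sum_(i < n) huber alpha (modulus (dotT (a i) x) ^+ 2 - b i).

(** At the search radius this is L / 2 over the complex numbers and L / 4 over the reals. *)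
Definition curvature (r : R) : R :=
  n%:R^-1 * \sum_(i < n) (alpha + 2 * r ^+ 2 * norm2 (a i) ^+ 2)
                         * norm2 (a i) ^+ 2.

Lemma grad_coord x j : grad a b alpha x j ord0 =
  of_real k n%:R^-1 * \sum_(i < n)
    of_real k (dhuber alpha (modulus (dotT (a i) x) ^+ 2 - b i)) *
    (dotT (a i) x * conj_scalar (a i j ord0)).
Proof.
rewrite mxE summxE; congr (_ * _); apply: eq_bigr => i _.
by rewrite !mxE mulrA.
Qed.

Lemma inner_grad x j d : inner (grad a b alpha x j ord0) d =
  n%:R^-1 * \sum_(i < n) dhuber alpha (modulus (dotT (a i) x) ^+ 2 - b i) *
                         inner (dotT (a i) x) (a i j ord0 * d).
Proof.
rewrite grad_coord inner_scale; congr (_ * _).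
rewrite (big_morph (inner^~ d) (fun u e => innerD u e d) (inner0 d)).
by apply: eq_bigr => i _; rewrite inner_scale inner_adjoint.
Qed.

(** Average the scalar descent over [i], with u = <a_i, x>, e = a_ij (w - x_j) and rho = r ||a_i||.
    Cauchy-Schwarz bounds both moduli by rho, and |a_ij| <= ||a_i||. *)
Lemma smooth_part_descent x j w (r : R) : 0 < alpha ->
  norm2 x <= r -> norm2 (update x j w) <= r ->
  smooth_part (update x j w) <= smooth_part x
    + 2 * inner (grad a b alpha x j ord0) (w - x j ord0)
    + curvature r * modulus (w - x j ord0) ^+ 2.
Proof.
move=> a0 xr vr; rewrite /smooth_part /curvature inner_grad.
rewrite mulrCA -mulrA -!mulrDr ler_wpM2l ?invr_ge0//.
rewrite mulr_sumr mulr_suml -!big_split /=; apply: ler_sum => i _.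
set d := w - x j ord0.
have := huber_sqr_modulus_descent alpha (b i) (r * norm2 (a i)) (dotT (a i) x)
  (a i j ord0 * d) a0.
have le_r y : norm2 y <= r -> modulus (dotT (a i) y) <= r * norm2 (a i).
  move=> yr; apply: le_trans (modulus_dotT_le _ _) _.
  by rewrite mulrC ler_wpM2r ?norm2_ge0.
rewrite -dotT_update => /(_ (le_r _ xr) (le_r _ vr)) => /le_trans; apply.
rewrite mulrCA lerD2l modulusM exprMn exprMn -/d [leLHS]mulrA [2 * (_ * _)]mulrA.
rewrite ler_wpM2r ?sqr_ge0// ler_wpM2l//.
  by apply: addr_ge0; [exact: ltW|rewrite -mulrA -exprMn mulr_ge0 ?sqr_ge0].
by rewrite ler_pXn2r ?nnegrE ?modulus_ge0 ?norm2_ge0 ?modulus_le_norm2.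
Qed.

(** Controls how far the gradient step can leave [x]; it accounts for the factor in
    [search_radius]. *)
Lemma modulus_grad_le x j : 0 <= alpha -> modulus (grad a b alpha x j ord0) <=
  alpha / n%:R * (\sum_(i < n) norm2 (a i) ^+ 2) * norm2 x.
Proof.
move=> a0; rewrite grad_coord modulusM modulus_of_real ger0_norm ?invr_ge0//.
rewrite [alpha / _]mulrC -!mulrA ler_wpM2l ?invr_ge0//.
apply: le_trans (modulus_sum_le _ _) _.
rewrite mulr_suml mulr_sumr; apply: ler_sum => i _.
rewrite !modulusM modulus_of_real modulus_conj.
rewrite ler_pM ?mulr_ge0 ?modulus_ge0 ?normr_dhuber_le//.
rewrite mulrC expr2 -mulrA ler_pM ?modulus_ge0 ?modulus_le_norm2//.
exact: modulus_dotT_le.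
Qed.

End Descent.

(** * Continuity of real-valued functions *)

Section RealValuedContinuity.
Context {R : realType} {T : topologicalType}.
Implicit Types f g : T -> R.

Lemma continuous_constR (c : R) : continuous (fun _ : T => c).
Proof. by move=> u; exact: cvg_cst. Qed.

Lemma continuous_addR f g : continuous f -> continuous g ->
  continuous (fun u => f u + g u).
Proof. by move=> fc gc u; apply: cvgD; [exact: fc|exact: gc]. Qed.

Lemma continuous_subR f g : continuous f -> continuous g ->
  continuous (fun u => f u - g u).
Proof. by move=> fc gc u; apply: cvgB; [exact: fc|exact: gc]. Qed.

Lemma continuous_mulR f g : continuous f -> continuous g ->
  continuous (fun u => f u * g u).
Proof. by move=> fc gc u; apply: cvgM; [exact: fc|exact: gc]. Qed.

Lemma continuous_compR f (h : R -> R) : continuous f -> continuous h ->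
  continuous (fun u => h (f u)).
Proof. by move=> fc hc u; apply: continuous_comp; [exact: fc|exact: hc]. Qed.

Lemma continuous_sumR (m : nat) (f : 'I_m -> T -> R) :
  (forall i, continuous (f i)) -> continuous (fun u => \sum_(i < m) f i u).
Proof.
move=> fc; apply: continuous_big => [v|i _]; last exact: fc.
exact: add_continuous.
Qed.

End RealValuedContinuity.

Lemma continuous_huber {R : realType} (alpha : R) : continuous (huber alpha).
Proof.
rewrite (_ : huber alpha = fun u => capped_norm alpha u * `|u| -
  2^-1 * (capped_norm alpha u * capped_norm alpha u)); last first.
  by apply/funext => u; exact: huberE.
have nc : continuous (fun u : R => `|u|) by exact: norm_continuous.
have mc : continuous (capped_norm alpha).
  by move=> u; apply: continuous_min; [exact: nc|exact: cvg_cst].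
apply: continuous_subR; apply: continuous_mulR => //.
  exact: continuous_constR.
exact: continuous_mulR.
Qed.

(** * Coercivity and existence of a global minimizer *)

Section Existence.
Context {R : realType} {k : scalar_kind} {p : nat}.
Local Notation H := (field_of R k).
Implicit Types x y : 'cV[H]_p.

Lemma re_part_le_modulus (z : H) : `|re_part z| <= modulus z.
Proof.
rewrite -(@ler_pXn2r _ 2) ?nnegrE ?modulus_ge0// real_normK ?num_real//.
by rewrite sqr_modulus lerDl sqr_ge0.
Qed.

Lemma im_part_le_modulus (z : H) : `|im_part z| <= modulus z.
Proof.
rewrite -(@ler_pXn2r _ 2) ?nnegrE ?modulus_ge0// real_normK ?num_real//.
by rewrite sqr_modulus lerDr sqr_ge0.
Qed.

Lemma re_part_of_parts (s t : R) : re_part (of_parts s t : H) = s.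
Proof. by case: k. Qed.

(** The constant factor is 1 over the complex numbers and 0 over the reals; this form is visibly
    continuous in [t]. *)
Lemma im_part_of_parts (s t : R) :
  im_part (of_parts s t : H) = im_part (of_parts 0 1 : H) * t.
Proof. by case: k => /=; rewrite ?mul0r ?mul1r. Qed.

(** A surjection from 2p real coordinates for both fields; over the reals the last p coordinates are
    ignored. *)
Definition vec_of_parts (u : 'rV[R]_(p + p)) : 'cV[H]_p :=
  \col_j of_parts (u ord0 (lshift p j)) (u ord0 (rshift p j)).

Definition parts_of_vec x : 'rV[R]_(p + p) :=
  row_mx (\row_j re_part (x j ord0)) (\row_j im_part (x j ord0)).

Lemma parts_of_vecK x : vec_of_parts (parts_of_vec x) = x.
Proof.
apply/matrixP => j i; rewrite (ord1 i) mxE /parts_of_vec row_mxEl row_mxEr !mxE.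
exact: of_partsK.
Qed.

Lemma parts_of_vec_le x i (M : R) : (forall j, modulus (x j ord0) <= M) ->
  `|parts_of_vec x ord0 i| <= M.
Proof.
move=> xM; rewrite /parts_of_vec; case: (split_ordP i) => j ->.
  by rewrite row_mxEl mxE (le_trans (re_part_le_modulus _)).
by rewrite row_mxEr mxE (le_trans (im_part_le_modulus _)).
Qed.

(** Stated through real parts so that only the topology of [R] enters on the target side. *)
Definition continuous_parts {T : topologicalType} (f : T -> H) :=
  continuous (fun u => re_part (f u)) /\ continuous (fun u => im_part (f u)).

Lemma continuous_coord_parts j :
  continuous_parts (fun u => vec_of_parts u j ord0).
Proof.
split.
  under eq_fun do rewrite mxE re_part_of_parts.
  exact: coord_continuous.
under eq_fun do rewrite mxE im_part_of_parts.
by apply: continuous_mulR; [exact: continuous_constR|exact: coord_continuous].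
Qed.

Lemma continuous_modulus {T : topologicalType} (f : T -> H) :
  continuous_parts f -> continuous (fun u => modulus (f u)).
Proof.
move=> [fr fi]; under eq_fun do rewrite modulusE !expr2.
apply: continuous_compR; last exact: sqrt_continuous.
by apply: continuous_addR; apply: continuous_mulR.
Qed.

Lemma continuous_parts_dotT (x : 'cV[H]_p) :
  continuous_parts (fun u => dotT x (vec_of_parts u)).
Proof.
have reS u : re_part (dotT x (vec_of_parts u)) = \sum_j
  (re_part (x j ord0) * re_part (vec_of_parts u j ord0) -
   im_part (x j ord0) * im_part (vec_of_parts u j ord0)).
  rewrite dotTE (big_morph _ re_partD re_part0).
  by apply: eq_bigr => j _; rewrite re_partM.
have imS u : im_part (dotT x (vec_of_parts u)) = \sum_j
  (re_part (x j ord0) * im_part (vec_of_parts u j ord0) +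
   im_part (x j ord0) * re_part (vec_of_parts u j ord0)).
  rewrite dotTE (big_morph _ im_partD im_part0).
  by apply: eq_bigr => j _; rewrite im_partM.
split.
  under eq_fun do rewrite reS.
  apply: continuous_sumR => j; have [jr ji] := continuous_coord_parts j.
  by apply: continuous_subR; apply: continuous_mulR => //; exact: continuous_constR.
under eq_fun do rewrite imS.
apply: continuous_sumR => j; have [jr ji] := continuous_coord_parts j.
by apply: continuous_addR; apply: continuous_mulR => //; exact: continuous_constR.
Qed.

Context {n : nat} (a : 'I_n -> 'cV[H]_p) (b : 'I_n -> R) (alpha lambda : R).
Hypotheses (alpha_gt0 : 0 < alpha) (lambda_gt0 : 0 < lambda).
Local Notation F := (objective a b alpha lambda).

Lemma objectiveE x : F x = smooth_part a b alpha x + lambda * half_norm x.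
Proof. by []. Qed.

Lemma continuous_objective : continuous (fun u => F (vec_of_parts u)).
Proof.
rewrite /objective /half_norm; apply: continuous_addR;
  (apply: continuous_mulR; first exact: continuous_constR).
  apply: continuous_sumR => i; apply: continuous_compR; last exact: continuous_huber.
  apply: continuous_subR; last exact: continuous_constR.
  by apply: continuous_mulR; apply: continuous_modulus; exact: continuous_parts_dotT.
apply: continuous_sumR => j; apply: continuous_compR; last exact: sqrt_continuous.
by apply: continuous_modulus; exact: continuous_coord_parts.
Qed.

(** Coercivity: the Huber terms are nonnegative, so [lambda] times a single square root is already
    at most [c]. *)
Lemma modulus_le_objective x (c : R) j : F x <= c ->
  modulus (x j ord0) <= (c / lambda) ^+ 2.
Proof.
move=> xc; rewrite -[leLHS]sqr_sqrtr ?modulus_ge0//.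
have h : Num.sqrt (modulus (x j ord0)) <= c / lambda.
  rewrite ler_pdivlMr// mulrC; apply: le_trans xc; rewrite objectiveE.
  rewrite ler_wpDl//.
    rewrite mulr_ge0 ?invr_ge0// sumr_ge0// => i _.
    exact/huber_ge0/ltW.
  rewrite ler_pM2l// /half_norm (bigD1 j)//= lerDl sumr_ge0//.
by rewrite ler_pXn2r ?nnegrE ?sqrtr_ge0// (le_trans _ h) ?sqrtr_ge0.
Qed.

(** The compact box [A] contains coordinates of every point of the sublevel set of [x0], so a
    minimum over [A] is global. *)
Lemma objective_minimizer (x0 : 'cV[H]_p) : exists x, forall y, F x <= F y.
Proof.
pose M := (F x0 / lambda) ^+ 2; have M0 : 0 <= M by exact: sqr_ge0.
pose A := [set u : 'rV[R]_(p + p) | forall i, `[- M, M]%classic (u ord0 i)].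
have inA y : F y <= F x0 -> A (parts_of_vec y).
  move=> yx0 i; rewrite /= in_itv /= -ler_norml.
  by apply: parts_of_vec_le => j; exact: modulus_le_objective.
have [|||c _ cmin] := @EVT_min_rV _ _ (fun u => F (vec_of_parts u)) A.
- by exists (parts_of_vec x0); exact: inA.
- exact: (@rV_compact R _ (fun=> `[- M, M]%classic) (fun=> @segment_compact _ _ _)).
- exact/continuous_subspaceT/continuous_objective.
have cA y : F y <= F x0 -> F (vec_of_parts c) <= F y.
  by move=> /inA yA; have := cmin _ (mem_set yA); rewrite parts_of_vecK.
exists (vec_of_parts c) => y; have [|/ltW yx0] := leP (F y) (F x0); first exact: cA.
exact: le_trans (cA x0 (lexx _)) yx0.
Qed.

(** Coercivity bounds the set of norms, so [sup] is a genuine supremum and not its default value. *)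
Lemma norm2_le_search_radius x0 x : F x <= F x0 ->
  norm2 x <= sup [set norm2 y | y in level_set a b alpha lambda x0].
Proof.
move=> xx0; apply: ub_le_sup; last by exists x.
exists (Num.sqrt (\sum_(j < p) ((F x0 / lambda) ^+ 2) ^+ 2)) => _ [y yx0 <-].
apply: ler_wsqrtr; apply: ler_sum => j _.
rewrite ler_pXn2r ?nnegrE ?modulus_ge0 ?sqr_ge0//.
exact: modulus_le_objective.
Qed.

End Existence.

(** * Step sizes and the fixed point inclusion *)

Lemma le_mine_inv (R : realType) (tau L : R) : 0 <= L ->
  (tau%:E <= mine 1 (1 / L%:E))%E -> tau <= 1 /\ tau * L <= 1.
Proof.
move=> L0; rewrite le_min => /andP[]; rewrite lee_fin => tau1.
rewrite mul1e inver; case: ifPn => [/eqP -> _|Ln0]; first by rewrite mulr0.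
by rewrite lee_fin -[_^-1]mul1r ler_pdivlMr// lt_def Ln0.
Qed.

Section FixedPoint.
Context {R : realType} {k : scalar_kind} {n p : nat}.
Local Notation H := (field_of R k).
Context (a : 'I_n -> 'cV[H]_p) (b : 'I_n -> R) (alpha lambda : R).
Context (x0 : 'cV[H]_p).
Hypotheses (alpha_gt0 : 0 < alpha) (lambda_gt0 : 0 < lambda).
Local Notation F := (objective a b alpha lambda).
Local Notation L := (lipschitz_const a b alpha lambda x0).
Local Notation radius := (search_radius a b alpha lambda x0).

Lemma curvature_ge0 (r : R) : 0 <= curvature a alpha r.
Proof.
rewrite mulr_ge0 ?invr_ge0// sumr_ge0// => i _.
rewrite mulr_ge0 ?sqr_ge0// addr_ge0 ?(ltW alpha_gt0)//.
by rewrite mulr_ge0 ?sqr_ge0// mulr_ge0 ?sqr_ge0.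
Qed.

(** Equality over the complex numbers; over the reals [L] is twice the left side. *)
Lemma curvature_le_lipschitz : 2 * curvature a alpha radius <= L.
Proof.
have := curvature_ge0 radius; rewrite /lipschitz_const /curvature.
set s := \sum_(i < n) _; case: (k) => h; last by rewrite mulrA.
by rewrite -mulrA ler_wpM2r // ler_nat.
Qed.

Lemma lipschitz_ge0 : 0 <= L.
Proof.
by apply: le_trans curvature_le_lipschitz; rewrite mulr_ge0 ?curvature_ge0.
Qed.

Lemma minimizer_fixed_point (x : 'cV[H]_p) (tau : R) :
  (forall y, F x <= F y) -> 0 < tau -> tau <= 1 -> tau * L <= 1 ->
  half_threshold (2 * lambda * tau)
    (x - of_real k (2 * tau) *: grad a b alpha x) x.
Proof.
move=> xmin tau0 tau1 tauL j.
set g := grad a b alpha x j ord0.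
have -> : (x - of_real k (2 * tau) *: grad a b alpha x) j ord0
    = x j ord0 - of_real k (2 * tau) * g.
  by rewrite mxE [X in _ + X]mxE [X in - X]mxE.
set xi := _ - _; apply: prox_minimizer_chi; first by rewrite !mulr_gt0.
move=> w wxi; pose d := w - x j ord0.
have xS := norm2_le_search_radius a b alpha lambda alpha_gt0 lambda_gt0 _ _
  (xmin x0).
set S := sup _ in xS.
have N0 := norm2_ge0 x.
pose c := 2 * alpha / n%:R * \sum_(i < n) norm2 (a i) ^+ 2.
have c0 : 0 <= c.
  rewrite mulr_ge0 ?divr_ge0 ?mulr_ge0 ?(ltW alpha_gt0)// sumr_ge0// => i _.
  exact: sqr_ge0.
have rE : radius = 4 / 3 * (c + 1) * S by [].
have gle : 2 * modulus g <= c * norm2 x.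
  have := modulus_grad_le a b alpha x j (ltW alpha_gt0).
  rewrite (_ : c = 2 * (alpha / n%:R * \sum_(i < n) norm2 (a i) ^+ 2)).
    by move=> ?; rewrite -(mulrA 2) ler_pM2l.
  by rewrite /c !mulrA.
have xr : norm2 x <= radius by rewrite rE; nra.
(* As tau <= 1, |w| <= |xi| <= |x_j| + 2 |g|, so the updated norm is at most (1 + c) ||x||, which
   the radius exceeds or equals. *)
have vr : norm2 (update x j w) <= radius.
  have g0 := modulus_ge0 g.
  have wle : modulus w <= modulus (x j ord0) + 2 * tau * modulus g.
    apply: le_trans wxi _; apply: le_trans (modulusD_le _ _) _.
    rewrite lerD2l (_ : - _ = of_real k (- (2 * tau)) * g); last first.
      by apply: scalar_ext; rewrite !parts_rules; ring.
    by rewrite modulusM modulus_of_real normrN gtr0_norm// mulr_gt0.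
  have dg0 : 0 <= 2 * tau * modulus g by rewrite !mulr_ge0// ltW.
  apply: le_trans (norm2_update_le _ _ _ _ dg0 wle) _.
  have : 2 * tau * modulus g <= c * norm2 x.
    by apply: le_trans gle; rewrite -mulrA ler_pM2l// ler_piMl.
  by rewrite rE; nra.
have := smooth_part_descent a b alpha x j w radius alpha_gt0 xr vr.
have := xmin (update x j w).
rewrite !objectiveE half_norm_update -/g -/d /prox_objective.
(* Both proximal terms expand around 2 tau g, whose squared modulus cancels in the comparison. *)
have -> : w - xi = of_real k (2 * tau) * g + d by rewrite /xi /d; ring.
have -> : x j ord0 - xi = of_real k (2 * tau) * g by rewrite /xi; ring.
rewrite (sqr_modulusD (_ * g) d) inner_scale.
set K := curvature _ _ _; set D := modulus d ^+ 2; set i := inner g d.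
set fv := smooth_part _ _ _ (update _ _ _); set fx := smooth_part _ _ _ _.
move=> Fmin fdesc.
(* Here tau L <= 1 lets |d|^2 absorb the curvature term. *)
have KD : tau * (2 * K) * D <= D.
  rewrite ler_piMl ?sqr_ge0//.
  by apply: le_trans tauL; rewrite ler_pM2l// curvature_le_lipschitz.
(* Minimality of [x] combined with the descent inequality, scaled by 2 tau to match the proximal
   objective. *)
have : 0 <= 2 * tau * (2 * i + K * D +
    lambda * (Num.sqrt (modulus w) - Num.sqrt (modulus (x j ord0)))).
  by apply: mulr_ge0; [rewrite mulr_ge0// ltW|lra].
by lra.
Qed.

End FixedPoint.

(* The bound on tau is taken in \bar R, where 1 / 0 = +oo: when every a i is 0,
   L = 0 and the bound min (1, 1 / L) is 1. *)
Theorem theorem4p4 (R : realType) (k : scalar_kind) (n p : nat)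
    (a : 'I_n -> 'cV[field_of R k]_p) (b : 'I_n -> R) (alpha lambda : R)
    (x0 : 'cV[field_of R k]_p)
    (n_gt0 : (0 < n)%N) (alpha_gt0 : 0 < alpha) (lambda_gt0 : 0 < lambda) :
  let L := lipschitz_const a b alpha lambda x0 in
  exists xhat : 'cV[field_of R k]_p,
    [/\ forall x : 'cV[field_of R k]_p,
          objective a b alpha lambda xhat <= objective a b alpha lambda x,
        level_set a b alpha lambda x0 xhat &
        forall tau : R, 0 < tau -> (tau%:E <= mine 1 (1 / L%:E))%E ->
          half_threshold (2 * lambda * tau)
            (xhat - of_real k (2 * tau) *: grad a b alpha xhat) xhat].
Proof.
move=> L.
have [x xmin] := objective_minimizer a b alpha lambda alpha_gt0 lambda_gt0 x0.
exists x; split=> // [|tau tau0 tauL]; first exact: xmin.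
have [tau1 tauL1] := le_mine_inv _ _ _ (lipschitz_ge0 a b _ lambda x0 alpha_gt0) tauL.
exact: minimizer_fixed_point tauL1.
Qed.
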